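(* For every integer $N\ge 3$, $$\tilde d_{2N-1}(x)=\lambda_{\lceil \frac{2N+2}{6}\rceil}(x)\,\tilde d_{2N-4}(xq^2)+xq^{2N-1}(1-xq)\,\tilde d_{2N-7}(xq^2).$$
   Context: Let $x,q$ be commuting indeterminates; $f(xq^2)$ denotes the result of substituting $xq^2$ for $x$ in $f(x)$. A Schur partition is a partition into positive integer parts such that any two parts differ by at least $3$ and no two consecutive multiples of $3$ (i.e. $3k$ and $3k+3$) both occur as parts; the empty partition is included. For $N\ge 1$ let $D_N(m,n)$ be the number of Schur partitions $\pi$ of $n$ with all parts $\le N$ such that (number of parts of $\pi$) + (number of even parts of $\pi$) $=m$. The Alladi-Schur polynomials are $d_N(x)=\sum_{m,n\ge 0}D_N(m,n)x^mq^n$ for $N\ge 1$, with the convention $d_{-1}(x)=d_0(x)=1$. Put $\lambda_k(x)=1+xq^{2k-1}+x^2q^{4k-2}$ for $k\ge 1$ and $p_n(x)=\prod_{i=1}^n\lambda_i(x)$ for $n\ge 0$ (so $p_0(x)=1$). Let $\chi_o(n)=1$ if $n$ is odd and $0$ if $n$ is even. For $n\ge -1$ define $$\tilde d_n(x)=\frac{d_n(x)}{p_{e(n)}(x)},\qquad e(n)=\left\lceil\frac{n+3\chi_o(n)}{6}\right\rceil-\chi_o(n);$$ in particular $\tilde d_{-1}(x)=1$. This quotient makes sense as a formal power series in $x$ over $\mathbb{Z}[q]$, since $p_{e(n)}(0)=1$; a theorem of Andrews states that $p_{e(n)}(x)$ divides $d_n(x)$. *)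

(* Defs.v *)
From HB Require Import structures.
From mathcomp Require Import all_boot all_order all_algebra.
From mathcomp Require Import boolp lra.

Set Implicit Arguments.
Unset Strict Implicit.
Unset Printing Implicit Defensive.

Import Order.TTheory GRing.Theory Num.Theory.
Local Open Scope ring_scope.

Record fps (R : Type) := Fps { fps_coef : nat -> R }.

Lemma fpsP (R : Type) (f g : fps R) : fps_coef f =1 fps_coef g -> f = g.
Proof. by case: f g => [f] [g] /= /funext ->. Qed.

(* Equality of power series is undecidable: the eqType and choiceType
   structures required by the ring hierarchy are classical. *)
HB.instance Definition _ (R : Type) := gen_eqMixin (fps R).
HB.instance Definition _ (R : Type) := gen_choiceMixin (fps R).

Section FpsZmod.
Variable R : zmodType.
Implicit Types f g h : fps R.

Definition fps_zero : fps R := Fps (fun=> 0).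
Definition fps_opp f := Fps (fun n => - fps_coef f n).
Definition fps_add f g := Fps (fun n => fps_coef f n + fps_coef g n).

Fact fps_addA : associative fps_add.
Proof. by move=> f g h; apply: fpsP => n /=; rewrite addrA. Qed.
Fact fps_addC : commutative fps_add.
Proof. by move=> f g; apply: fpsP => n /=; rewrite addrC. Qed.
Fact fps_add0 : left_id fps_zero fps_add.
Proof. by move=> f; apply: fpsP => n /=; rewrite add0r. Qed.
Fact fps_addN : left_inverse fps_zero fps_opp fps_add.
Proof. by move=> f; apply: fpsP => n /=; rewrite addNr. Qed.

HB.instance Definition _ :=
  GRing.isZmodule.Build (fps R) fps_addA fps_addC fps_add0 fps_addN.
End FpsZmod.

Section FpsRing.
Variable R : comNzRingType.
Implicit Types f g h : fps R.

Definition fps_one : fps R := Fps (fun n => (n == 0)%:R).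
Definition fps_mul f g :=
  Fps (fun n => \sum_(i < n.+1) fps_coef f i * fps_coef g (n - i)).

Definition fps_trunc n f : {poly R} := \poly_(i < n) fps_coef f i.

Lemma coef_fps_mul n k f g : (k < n)%N ->
  fps_coef (fps_mul f g) k = (fps_trunc n f * fps_trunc n g)`_k.
Proof.
move=> ltkn; rewrite coefM /=; apply: eq_bigr => i _.
by rewrite !coef_poly !(leq_ltn_trans _ ltkn) ?leq_subr // -ltnS.
Qed.

Fact fps_mulC : commutative fps_mul.
Proof. by move=> f g; apply: fpsP => n; rewrite !(coef_fps_mul _ _ (ltnSn n)) mulrC. Qed.

Fact fps_mulA : associative fps_mul.
Proof.
move=> f g h; apply: fpsP => n; set N := n.+1.
have E u v k : (k < N)%N ->
    (fps_trunc N (fps_mul u v))`_k = (fps_trunc N u * fps_trunc N v)`_k.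
  by move=> kN; rewrite coef_poly kN (coef_fps_mul _ _ kN).
rewrite !(coef_fps_mul _ _ (ltnSn n)) -/N.
transitivity (fps_trunc N f * (fps_trunc N g * fps_trunc N h))`_n.
  by rewrite !coefM; apply: eq_bigr => i _; rewrite E // ltnS leq_subr.
by rewrite mulrA !coefM; apply: eq_bigr => i _; rewrite E.
Qed.

Fact fps_mul1 : left_id fps_one fps_mul.
Proof.
move=> f; apply: fpsP => n /=; rewrite big_ord_recl /= mul1r subn0.
by rewrite big1 ?addr0 // => i _; rewrite mul0r.
Qed.

Fact fps_mulDl : left_distributive fps_mul +%R.
Proof.
move=> f g h; apply: fpsP => n /=; rewrite -big_split /=.
by apply: eq_bigr => i _; rewrite mulrDl.
Qed.

Fact fps_one_neq0 : fps_one != 0.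
Proof.
apply/eqP => /(congr1 (fun f => fps_coef f 0)) /= /eqP.
by rewrite oner_eq0.
Qed.

HB.instance Definition _ := GRing.Zmodule_isComNzRing.Build (fps R)
  fps_mulA fps_mulC fps_mul1 fps_mulDl fps_one_neq0.

Lemma fps_coefM f g n :
  fps_coef (f * g) n = \sum_(i < n.+1) fps_coef f i * fps_coef g (n - i).
Proof. by []. Qed.

Definition fps_of_poly (p : {poly R}) : fps R := Fps (fun n => p`_n).

Fact fps_of_poly_is_zmod_morphism : zmod_morphism fps_of_poly.
Proof. by move=> p s; apply: fpsP => n /=; rewrite coefB. Qed.
Fact fps_of_poly_is_monoid_morphism : monoid_morphism fps_of_poly.
Proof.
split; first by apply: fpsP => n /=; rewrite coef1.
by move=> p s; apply: fpsP => n /=; rewrite coefM.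
Qed.
HB.instance Definition _ :=
  GRing.isZmodMorphism.Build {poly R} (fps R) fps_of_poly
    fps_of_poly_is_zmod_morphism.
HB.instance Definition _ :=
  GRing.isMonoidMorphism.Build {poly R} (fps R) fps_of_poly
    fps_of_poly_is_monoid_morphism.

(* [fps_scale c f] is f(c x). *)
Definition fps_scale (c : R) f := Fps (fun n => c ^+ n * fps_coef f n).

Fact fps_scale_is_zmod_morphism c : zmod_morphism (fps_scale c).
Proof. by move=> f g; apply: fpsP => n /=; rewrite mulrBr. Qed.
Fact fps_scale_is_monoid_morphism c : monoid_morphism (fps_scale c).
Proof.
split=> [|f g]; apply: fpsP => n /=; first by case: n => [|n]; rewrite ?mul1r ?mulr0.
rewrite mulr_sumr; apply: eq_bigr => i _ /=.
by rewrite mulrACA -exprD subnKC // -ltnS.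
Qed.
HB.instance Definition _ c :=
  GRing.isZmodMorphism.Build (fps R) (fps R) (fps_scale c)
    (fps_scale_is_zmod_morphism c).
HB.instance Definition _ c :=
  GRing.isMonoidMorphism.Build (fps R) (fps R) (fps_scale c)
    (fps_scale_is_monoid_morphism c).

Lemma fps_scale_poly c p :
  fps_scale c (fps_of_poly p) = fps_of_poly (p \Po (c *: 'X)).
Proof.
apply: fpsP => n /=; rewrite coef_comp_poly.
transitivity (\sum_(i < size p) if i == n :> nat then c ^+ n * p`_n else 0).
  case: (ltnP n (size p)) => [lt_n|le_n].
    rewrite (bigD1 (Ordinal lt_n)) //= eqxx big1 ?addr0 // => i.
    by rewrite -val_eqE /= => /negPf ->.
  rewrite big1 ?nth_default ?mulr0 // => i _.
  by case: eqP => // _; rewrite mulr0.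
apply: eq_bigr => i _; rewrite exprZn coefZ coefXn eq_sym.
by case: eqP => [->|_]; rewrite ?mulr1 ?mulr0 // mulrC.
Qed.

End FpsRing.

Section FpsUnit.
Variable R : comUnitRingType.
Implicit Types f g : fps R.

Definition fps_unit : pred (fps R) := fun f => fps_coef f 0 \is a GRing.unit.

(* The first n coefficients of the inverse of a series with invertible
   constant term. *)
Fixpoint fps_inv_seq f n : seq R :=
  if n is m.+1 then
    let s := fps_inv_seq f m in
    rcons s ((fps_coef f 0)^-1 *
             ((m == 0)%:R - \sum_(i < m) s`_i * fps_coef f (m - i)))
  else [::].

(* As for every [unitRingType], the inverse of a non-unit is itself. *)
Definition fps_inv f : fps R :=
  if fps_unit f then Fps (fun n => (fps_inv_seq f n.+1)`_n) else f.

Lemma size_fps_inv_seq f n : size (fps_inv_seq f n) = n.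
Proof. by elim: n => //= n IHn; rewrite size_rcons IHn. Qed.

Lemma nth_fps_inv_seq f n i : (i < n)%N ->
  (fps_inv_seq f n)`_i = (fps_inv_seq f i.+1)`_i.
Proof.
elim: n => // n IHn; rewrite ltnS leq_eqVlt => /predU1P[-> // | lt_in].
by rewrite [in LHS]/= nth_rcons size_fps_inv_seq lt_in IHn.
Qed.

Fact fps_mulV : {in fps_unit, left_inverse 1 fps_inv *%R}.
Proof.
move=> f Uf; apply: fpsP => n; rewrite fps_coefM /fps_inv [fps_unit f]Uf.
rewrite big_ord_recr /= subnn.
have -> : \sum_(i < n) (rcons (fps_inv_seq f i)
    ((fps_coef f 0)^-1 * (((i : nat) == 0)%:R -
       \sum_(j < i) (fps_inv_seq f i)`_j * fps_coef f (i - j))))`_i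
       * fps_coef f (n - i)
  = \sum_(i < n) (fps_inv_seq f n)`_i * fps_coef f (n - i).
  by apply: eq_bigr => i _; rewrite (nth_fps_inv_seq _ (ltn_ord i)).
rewrite nth_rcons size_fps_inv_seq ltnn eqxx mulrAC mulVr // mul1r.
by rewrite addrC subrK.
Qed.

Fact fps_unitPl f g : g * f = 1 -> fps_unit f.
Proof.
move=> /(congr1 (fun h => fps_coef h 0)); rewrite fps_coefM big_ord1 /=.
by move=> gf1; apply/unitrPr; exists (fps_coef g 0); rewrite mulrC.
Qed.

Fact fps_inv_out : {in [predC fps_unit], fps_inv =1 id}.
Proof. by move=> f /negP Uf; rewrite /fps_inv; case: ifP => // /Uf. Qed.

HB.instance Definition _ :=
  GRing.ComNzRing_hasMulInverse.Build (fps R) fps_mulV fps_unitPl fps_inv_out.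

Lemma fps_unitE f : (f \is a GRing.unit) = (fps_coef f 0 \is a GRing.unit).
Proof. by []. Qed.

End FpsUnit.

Section Schur.
Local Open Scope nat_scope.

(* Partitions are weakly decreasing sequences of positive integers. *)
Definition is_partition (s : seq nat) : bool :=
  sorted geq s && all (leq 1) s.

(* In a weakly decreasing sequence, a part a listed before b satisfies
   a >= b, so that [a - b] is the difference of the two parts. *)
Definition is_schur (s : seq nat) : bool :=
  [&& is_partition s,
      pairwise (fun a b => 3 <= a - b) s
    & all (fun a => (3 %| a) ==> (a + 3 \notin s)) s].

Definition schur_weight (s : seq nat) : nat := size s + count (predC odd) s.

(* A partition of n has at most n parts, so bounded sequences of length at
   most n over {0, ..., N} contain all partitions of n with parts <= N. *)
Definition schur_count (N m n : nat) : nat :=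
  #|[set t : n.-bseq 'I_N.+1 |
      let s := map val t in
      [&& is_schur s, sumn s == n & schur_weight s == m]]|.

Lemma schur_size_le N s :
  is_schur s -> all (fun a => a <= N) s -> size s <= N.
Proof.
move=> /and3P[/andP[_ pos_s] pw_s _] leN.
have uniq_s : uniq s.
  rewrite uniq_pairwise; apply: sub_pairwise pw_s => a b.
  by move=> le3; apply/eqP => eq_ab; rewrite eq_ab subnn in le3.
rewrite -[leqRHS](size_iota 1); apply: uniq_leq_size => // a a_s.
by rewrite mem_iota add1n ltnS (allP pos_s) // (allP leN).
Qed.

Lemma schur_count_bound N m n :
  0 < schur_count N m n -> (m <= 2 * N) && (n <= N * N).
Proof.
case/card_gt0P => t; rewrite inE /=; set s := map _ _.
case/and3P=> schur_s /eqP <- /eqP <-.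
have leN : all (fun a => a <= N) s.
  by apply/allP => _ /mapP[i _ ->]; rewrite -ltnS ltn_ord.
have le_size := schur_size_le schur_s leN.
apply/andP; split.
  apply: leq_trans (_ : size s + size s <= _); first by rewrite leq_add2l count_size.
  by rewrite addnn -mul2n leq_mul2l le_size.
have: sumn s <= size s * N.
  elim: (s) leN => //= a r IHr /andP[leaN /IHr]; rewrite mulSn.
  exact: leq_add.
by move=> /leq_trans -> //; rewrite leq_mul2r le_size orbT.
Qed.
End Schur.

(* The ring Z[q][x]; elements of Z[q] are the inner polynomials. *)
Notation Zqx := {poly {poly int}}.
Definition vx : Zqx := 'X.
Definition vq : Zqx := ('X)%:P.

(* The double sum over m, n is cut at bounds beyond which the counts vanish;
   see [coef_schur_poly]. *)
Definition schur_poly (N : nat) : Zqx :=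
  \poly_(m < (2 * N).+1) \poly_(n < (N * N).+1) (schur_count N m n)%:Z.

Lemma coef_schur_poly N m n : (schur_poly N)`_m`_n = (schur_count N m n)%:Z.
Proof.
rewrite coef_poly (fun_if (fun p : {poly int} => p`_n)) coef_poly coef0 !ltnS.
have := @schur_count_bound N m n; case: posnP => [-> _ | _ /(_ isT)/andP[-> ->] //].
by do 2![case: ifP => //].
Qed.

(* d_{-1} = d_0 = 1; indices below -1 are never used. *)
Definition alladi_schur (n : int) : Zqx :=
  if 1 <= n then schur_poly `|n|%N else 1.

Definition lambda (k : nat) : Zqx :=
  1 + vx * vq ^+ (2 * k - 1) + vx ^+ 2 * vq ^+ (4 * k - 2).

Definition pprod (n : nat) : Zqx := \prod_(1 <= i < n.+1) lambda i.

Definition chi_odd (n : int) : int := (~~ (2 %| n)%Z)%:Z.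

(* Nonnegative for n >= -1 by [eexp_ge0], so that the absolute value in
   [dtilde] is harmless. *)
Definition eexp (n : int) : int :=
  Num.ceil ((n + 3 * chi_odd n)%:~R / 6 : rat) - chi_odd n.

Lemma eexp_ge0 n : -1 <= n -> 0 <= eexp n.
Proof.
rewrite -(ler_int rat) /eexp subr_ge0 /chi_odd => n_ge.
case: (2 %| n)%Z => /=; last by rewrite -gtz0_ge1 ceil_gt0 rmorphD /=; lra.
by rewrite ceil_ge0 mulr0 addr0; lra.
Qed.

Definition dtilde (n : int) : fps {poly int} :=
  fps_of_poly (alladi_schur n) / fps_of_poly (pprod `|eexp n|%N).

(* The quotient [dtilde] is a genuine one: the denominator is invertible. *)
Lemma pprod_unit n : fps_of_poly (pprod n) \is a GRing.unit.
Proof.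
rewrite fps_unitE /= -horner_coef0 horner_prod big1 ?unitr1 // => i _.
by rewrite /lambda /vx /vq -rmorphXn /= !hornerE /= expr0n /= !mul0r !addr0.
Qed.

Definition subst_xq2 (f : fps {poly int}) : fps {poly int} :=
  fps_scale ('X ^+ 2) f.

(* Main.v *)
Require Import Defs.
From mathcomp Require Import all_boot all_order all_algebra.
From mathcomp Require Import zify ring lra.

Set Implicit Arguments.
Unset Strict Implicit.
Unset Printing Implicit Defensive.

Import Order.TTheory GRing.Theory Num.Theory.
Local Open Scope ring_scope.

(** Removing the largest part n of a Schur partition leaves an arbitrary Schur
    partition with parts at most n - 3, or at most n - 4 when 3 divides n.
    Since n carries the weight x q^n (n odd) or x^2 q^n (n even), this gives
    [schur_poly_rec]:
      d_n = d_(n-1) + x^(1 + [n even]) q^n d_(n - gap n),  gap n = 3 or 4.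
    The series e_n = d_n(x q^2) obey the same recurrence with x q^2 for x.

    After multiplication by p_(e(2N-1))(x), and because
    lambda_1(x) p_k(x q^2) = p_(k+1)(x) ([subst_pprod]), all denominators
    cancel and the claim becomes, for n = 2N - 1,
      d_n = (1 + x q + x^2 q^2) (e_(n-3) + x q^n (1 - x q) e_(n-6)).
    This is [shift_identity]; it holds for odd n >= 5 by induction in steps of
    6, the period of the recurrence. With even indices eliminated, the
    recurrence determines d_(6j+9), d_(6j+11), d_(6j+13) from d_(6j+5) and
    d_(6j+7) alone, and the right-hand sides satisfy the same relations: once
    e_(6j+2), ..., e_(6j+10) are expressed through e_(6j-1) and e_(6j+1), the
    three relations needed become polynomial identities in x, q and
    Q = q^(6j) ([shift_identity_step]). The initial values enter only through
    n = 5 and n = 7 ([shift_identity_base]). *)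

(** * The partitions as a finite list *)

Definition bounded_seqs (k N : nat) : seq (seq nat) :=
  [seq map val (t : seq 'I_N.+1) | t : k.-bseq 'I_N.+1].

Lemma bounded_seqs_inj k N :
  injective (fun t : k.-bseq 'I_N.+1 => map val (t : seq 'I_N.+1)).
Proof. by move=> s t /(inj_map val_inj) /val_inj. Qed.

Lemma mem_bounded_seqs k N s :
  (s \in bounded_seqs k N) = (size s <= k)%N && all (fun a => a <= N)%N s.
Proof.
apply/mapP/andP => [[t _ ->] | [le_k /allP le_N]].
  rewrite size_map size_bseq; split=> //.
  by apply/allP => _ /mapP[i _ ->]; rewrite -ltnS ltn_ord.
have size_t : (size [seq inord a : 'I_N.+1 | a <- s] <= k)%N by rewrite size_map.
exists (Bseq size_t); rewrite ?mem_enum //= -map_comp -[LHS]map_id.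
by apply/eq_in_map => a /le_N le_a /=; rewrite inordK.
Qed.

(** By [schur_size_le], the length bound N loses no Schur partition with parts
    at most N. *)
Definition schur_list (N : nat) : seq (seq nat) :=
  [seq s <- bounded_seqs N N | is_schur s].

Lemma mem_schur_list N s :
  (s \in schur_list N) = is_schur s && all (fun a => a <= N)%N s.
Proof.
rewrite mem_filter mem_bounded_seqs; case schur_s: (is_schur s) => //=.
by case le_N: (all _ s); rewrite ?andbF // (schur_size_le schur_s).
Qed.

Lemma schur_list_uniq N : uniq (schur_list N).
Proof.
by rewrite filter_uniq // (map_inj_uniq (@bounded_seqs_inj _ _)) enum_uniq.
Qed.

Lemma size_le_sumn s : all (leq 1) s -> (size s <= sumn s)%N.
Proof. by elim: s => //= a s IHs /andP[a_gt0 /IHs]; lia. Qed.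

(** The set counted by [schur_count] bounds the length by the weight n, while
    the list bounds it by N; on Schur partitions of n with parts at most N both
    bounds hold automatically. *)
Lemma schur_count_list N m n :
  schur_count N m n =
    count (fun s => (sumn s == n) && (schur_weight s == m)) (schur_list N).
Proof.
rewrite /schur_count -size_filter cardE.
rewrite -(size_map (fun t : n.-bseq _ => map val (t : seq 'I_N.+1))).
apply/perm_size/uniq_perm.
- by rewrite (map_inj_uniq (@bounded_seqs_inj _ _)) enum_uniq.
- by rewrite filter_uniq // schur_list_uniq.
move=> s; rewrite mem_filter mem_schur_list.
apply/mapP/andP=> [[t]|[/andP[/eqP sum_s /eqP wt_s] /andP[schur_s le_N]]].
  rewrite mem_enum inE => /and3P[schur_t sum_t wt_t] ->.
  rewrite sum_t wt_t schur_t; split=> //.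
  by apply/allP => _ /mapP[i _ ->]; rewrite -ltnS ltn_ord.
have: s \in bounded_seqs n N.
  rewrite mem_bounded_seqs le_N andbT -sum_s size_le_sumn //.
  by case/and3P: schur_s => /andP[].
case/mapP=> t _ def_s; exists t => //.
by rewrite mem_enum inE -def_s schur_s sum_s wt_s !eqxx.
Qed.

Definition schur_monomial (s : seq nat) : Zqx :=
  vx ^+ schur_weight s * vq ^+ sumn s.

Lemma coef_schur_monomial s m n :
  (schur_monomial s)`_m`_n = ((sumn s == n) && (schur_weight s == m))%:R.
Proof.
rewrite /schur_monomial /vx /vq -rmorphXn coefMC coefXn eq_sym.
case: eqP => _; rewrite ?mul0r ?coef0 ?andbF // mul1r coefXn eq_sym.
by rewrite andbT.
Qed.

Lemma schur_poly_list N : schur_poly N = \sum_(s <- schur_list N) schur_monomial s.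
Proof.
apply/polyP => m; apply/polyP => n; rewrite coef_schur_poly schur_count_list.
rewrite !coef_sum -sum1_count -natz natr_sum big_mkcond /=.
by apply: eq_bigr => s _; rewrite coef_schur_monomial; case: ifP.
Qed.

(** * The recurrence given by the largest part *)

(** The least difference allowed between a part a and the next smaller part:
    a difference of exactly 3 below a multiple of 3 would give two consecutive
    multiples of 3. *)
Definition schur_gap (a : nat) : nat := 3 + (3 %| a)%N.

(** The pairwise conditions on the tail and a single gap condition below the
    largest part suffice: if 3 does not divide a, then neither does a - 3. *)
Lemma is_schur_cons a s :
  is_schur (a :: s) =
    [&& (0 < a)%N, is_schur s & all (fun b => b + schur_gap a <= a)%N s].
Proof.
have geq_trans : transitive geq by move=> b c d; lia.
rewrite /is_schur /is_partition /= path_sortedE //.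
have -> : ((3 %| a) ==> (a + 3 \notin a :: s))%N = ((3 %| a) ==> (a + 3 \notin s))%N.
  by rewrite inE; case: eqP => //; lia.
apply/idP/idP.
  case/and4P=> /andP[/andP[_ sorted_s] /andP[a_gt0 pos_s]] /andP[far_a far_s] _.
  move=> /allP three_s; rewrite a_gt0 sorted_s pos_s far_s /=.
  apply/andP; split; apply/allP => b b_s.
    by have := three_s b b_s; rewrite inE negb_or; case: (3 %| b)%N => //= /andP[].
  have := three_s b b_s; have := allP far_a b b_s.
  rewrite /schur_gap inE negb_or /=; lia.
case/and3P=> a_gt0 /and3P[/andP[sorted_s pos_s] far_s /allP three_s] /allP gap_a.
rewrite a_gt0 sorted_s pos_s far_s !andbT /=.
apply/and4P; split.
- by apply/allP => b /gap_a; rewrite /schur_gap /=; lia.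
- by apply/allP => b /gap_a; rewrite /schur_gap /=; lia.
- by apply/implyP => _; apply/negP => /gap_a; lia.
apply/allP => b b_s; rewrite inE negb_or.
have := three_s b b_s; have := gap_a b b_s; rewrite /schur_gap /=.
case: (3 %| b)%N / boolP => //= d3 + ->; lia.
Qed.

(** The second list collects the partitions whose largest part is n.+1. When
    n.+1 is smaller than its gap, the truncated bound is 0, which rightly
    leaves only the empty tail. *)
Lemma perm_schur_listS n :
  perm_eq (schur_list n.+1)
    (schur_list n ++ map (cons n.+1) (schur_list (n.+1 - schur_gap n.+1))).
Proof.
apply: uniq_perm; first exact: schur_list_uniq.
  rewrite cat_uniq schur_list_uniq map_inj_uniq ?schur_list_uniq ?andbT //=.
    apply/hasPn => _ /mapP[s _ ->]; rewrite mem_schur_list negb_and /=.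
    by rewrite ltnn orbT.
  by move=> s t [].
move=> s; rewrite mem_cat !mem_schur_list.
have step t : is_schur (n.+1 :: t) = (t \in schur_list (n.+1 - schur_gap n.+1)).
  rewrite is_schur_cons mem_schur_list /=; case schur_t: (is_schur t) => //=.
  apply: eq_in_all => b b_t; have b_gt0 : (0 < b)%N.
    by case/and3P: schur_t => /andP[_ /allP->].
  lia.
case: s => [|a s].
  by [].
have -> : (a :: s \in map (cons n.+1) (schur_list (n.+1 - schur_gap n.+1)))
   = (a == n.+1) && is_schur (n.+1 :: s).
  rewrite step; apply/mapP/andP => [[t t_in [-> ->]]|[/eqP -> s_in]] //.
  by exists s.
rewrite /=; case: (ltngtP a n.+1) => [lt_a|gt_a|->].
- rewrite orbF -ltnS lt_a /=.
  case: (boolP (is_schur (a :: s))) => //=; rewrite is_schur_cons.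
  case/and3P=> _ _ /allP gap.
  by apply/idP/idP => _; apply/allP => b /gap; rewrite /schur_gap; lia.
- by rewrite [(a <= n)%N]leqNgt (ltnW gt_a) !andbF.
rewrite ltnn andbF /= andbC andb_idl // is_schur_cons.
by case/and3P=> _ _ /allP gap; apply/allP => b /gap; lia.
Qed.

(** Truncation of the last index at 0 is sound: for a negative bound on the
    parts, as for the bound 0, only the empty partition remains. *)
Definition schur_rec (R : comNzRingType) (x q : R) (d : nat -> R) : Prop :=
  d 0%N = 1 /\
  forall n, d n.+1 = d n
    + x ^+ (1 + ~~ odd n.+1) * q ^+ n.+1 * d (n.+1 - schur_gap n.+1)%N.

Lemma schur_weight_cons a s :
  schur_weight (a :: s) = (1 + ~~ odd a + schur_weight s)%N.
Proof. by rewrite /schur_weight /= addnACA. Qed.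

Lemma schur_poly_rec : schur_rec vx vq schur_poly.
Proof.
split=> [|n].
  rewrite schur_poly_list (perm_big [:: [::]]) ?big_seq1.
    by rewrite /schur_monomial /= !expr0 mulr1.
  apply: uniq_perm => [||[|a s]] //; rewrite ?schur_list_uniq //.
    by rewrite mem_schur_list.
  by rewrite mem_schur_list is_schur_cons /= inE; case: a => //= a; rewrite andbF.
rewrite !schur_poly_list (perm_big _ (perm_schur_listS n)) big_cat big_map.
rewrite mulr_sumr; congr (_ + _); apply: eq_bigr => s _.
by rewrite /schur_monomial schur_weight_cons !exprD mulrACA.
Qed.

Lemma schur_rec_morph (R S : comNzRingType) (f : {rmorphism R -> S}) x q d :
  schur_rec x q d -> schur_rec (f x) (f q) (f \o d).
Proof.
case=> d0 dS; split=> [|n] /=; first by rewrite d0 rmorph1.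
by rewrite dS rmorphD !rmorphM !rmorphXn.
Qed.

(** * The transformation x -> x q^2 at odd indices *)

Section Shift.
Variables (R : comNzRingType) (x q : R) (d e : nat -> R).
Hypothesis rec_d : schur_rec x q d.
Hypothesis rec_e : schur_rec (x * q ^+ 2) q e.

(** The theorem for n = 2N - 1 with denominators cleared; n - 3 = 2N - 4 and
    n - 6 = 2N - 7. *)
Definition shift_identity (n : nat) : Prop :=
  d n = (1 + x * q + x ^+ 2 * q ^+ 2)
          * (e (n - 3)%N + x * q ^+ n * (1 - x * q) * e (n - 6)%N).

(** The parity of n and its divisibility by 3, hence the shape of the
    recurrence, depend only on n modulo 6. *)
Lemma schur_rec_mod6 (y : R) (c : nat -> R) : schur_rec y q c ->
  forall j r, c (6 * j + r.+1)%N = c (6 * j + r)%N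
    + y ^+ (1 + ~~ odd r.+1) * (q ^+ (6 * j) * q ^+ r.+1)
      * c (6 * j + r.+1 - schur_gap r.+1)%N.
Proof.
case=> _ cS j r; rewrite -exprD addnS cS -addnS oddD oddM /=.
by congr (_ + _ * c (_ - _)%N); rewrite /schur_gap; congr (_ + nat_of_bool _)%N; lia.
Qed.

(** Over one period, the recurrences turn both sides into polynomials in
    x, q, q^(6j) and the two free values e_(6j-1) and e_(6j+1); as such the
    two sides agree term by term. *)
Lemma shift_identity_step j :
  shift_identity (6 * j + 5) -> shift_identity (6 * j + 7) ->
  [/\ shift_identity (6 * j + 9), shift_identity (6 * j + 11)
    & shift_identity (6 * j + 13)].
Proof.
have := schur_rec_mod6 rec_d j; have := schur_rec_mod6 rec_e j.
rewrite /shift_identity; move: (6 * j)%N => m; rewrite !(exprD q m).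
(* The index 6j - 1 is truncated when j = 0, so it is kept as one symbol p. *)
have pred_sub r : (m + r - r.+1 = m - 1)%N by lia.
move: (q ^+ m) (m - 1)%N pred_sub => Q p pred_sub eS dS.
have := eS 1%N; rewrite (_ : schur_gap 2 = 3%N) // pred_sub => e2.
have := eS 2%N; rewrite (_ : schur_gap 3 = 4%N) // pred_sub => e3.
have gapE r : (3 <= r)%N ->
    (m + r.+1 - schur_gap r.+1 = m + (r.+1 - schur_gap r.+1))%N.
  by rewrite /schur_gap; lia.
have eE r (r_ge : (3 <= r)%N) := etrans (eS r)
  (congr1 (fun i => _ + _ * e i) (gapE r r_ge)).
have dE r (r_ge : (3 <= r)%N) := etrans (dS r)
  (congr1 (fun i => _ + _ * d i) (gapE r r_ge)).
have e4 := eE 3%N isT; have e5 := eE 4%N isT; have e6 := eE 5%N isT.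
have e7 := eE 6%N isT; have e8 := eE 7%N isT; have e9 := eE 8%N isT.
have e10 := eE 9%N isT; have d8 := dE 7%N isT; have d9 := dE 8%N isT.
have d10 := dE 9%N isT; have d11 := dE 10%N isT; have d12 := dE 11%N isT.
have d13 := dE 12%N isT.
rewrite /schur_gap /subn /= in e4 e5 e6 e7 e8 e9 e10 d8 d9 d10 d11 d12 d13.
rewrite pred_sub -!addnBA // /subn /= => d5 d7.
(* Descending order, so that every right-hand side is expanded in turn. *)
rewrite d13 d12 d11 d10 d9 d8 d7 d5.
rewrite e10 e9 e8 e7 e6 e5 e4 e3 e2.
by split; ring.
Qed.

Lemma shift_identity_base : shift_identity 5 /\ shift_identity 7.
Proof.
have [d0 dS] := rec_d; have [e0 eS] := rec_e.
have d1 := dS 0%N; have d2 := dS 1%N; have d3 := dS 2%N; have d4 := dS 3%N.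
have d5 := dS 4%N; have d6 := dS 5%N; have d7 := dS 6%N.
have e1 := eS 0%N; have e2 := eS 1%N; have e3 := eS 2%N; have e4 := eS 3%N.
rewrite /schur_gap /subn /= in d1 d2 d3 d4 d5 d6 d7 e1 e2 e3 e4.
rewrite /shift_identity /subn /= d7 d6 d5 d4 d3 d2 d1 d0 e4 e3 e2 e1 e0.
by split; ring.
Qed.

Lemma shift_identity_odd N : (3 <= N)%N -> shift_identity (2 * N - 1).
Proof.
have all_mod j : [/\ shift_identity (6 * j + 5), shift_identity (6 * j + 7)
                   & shift_identity (6 * j + 9)].
  (* The step yields 6j + 11 and 6j + 13, that is, 5 and 7 in the next period;
     applying it once more gives 9. *)
  elim: j => [|j [id5 id7 _]].
    have [id5 id7] := shift_identity_base; split=> //.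
    by have [] := @shift_identity_step 0 id5 id7.
  have [_ id11 id13] := shift_identity_step id5 id7.
  have id11' : shift_identity (6 * j.+1 + 5) by rewrite mulnSr -addnA.
  have id13' : shift_identity (6 * j.+1 + 7) by rewrite mulnSr -addnA.
  by split=> //; have [] := shift_identity_step id11' id13'.
move=> N_ge; have [id5 id7 id9] := all_mod ((N - 3) %/ 3)%N.
have: (2 * N - 1 \in [:: 6 * ((N - 3) %/ 3) + 5; 6 * ((N - 3) %/ 3) + 7;
                         6 * ((N - 3) %/ 3) + 9])%N by rewrite !inE; lia.
by rewrite !inE => /or3P[] /eqP ->.
Qed.

End Shift.

(** * Clearing denominators *)

Lemma ceil_div6 (n : nat) : Num.ceil (n%:R / 6 : rat) = ((n + 5) %/ 6)%N%:Z.
Proof.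
set c := (_ %/ _)%N; have c_ge : (n <= 6 * c)%N by rewrite /c; lia.
have c_lt : (6 * c < n + 6)%N by rewrite /c; lia.
move: c_ge c_lt; rewrite -(ler_nat rat) -(ltr_nat rat) natrD !natrM => c_ge c_lt.
by apply: ceil_def; rewrite rmorphB /= -pmulrn; apply/andP; split; lra.
Qed.

Lemma subst_vq : subst_xq2 (fps_of_poly vq) = fps_of_poly vq.
Proof.
apply: fpsP => -[|n] /=; first by rewrite expr0 mul1r.
by rewrite /vq coefC mulr0.
Qed.

Lemma subst_vx : subst_xq2 (fps_of_poly vx) = fps_of_poly (vx * vq ^+ 2).
Proof.
apply: fpsP => n /=; rewrite /vx /vq -rmorphXn coefMC coefX mulrC.
by case: eqP => [->|_]; rewrite ?mul0r // expr1.
Qed.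

Lemma subst_lambda k :
  (0 < k)%N -> subst_xq2 (fps_of_poly (lambda k)) = fps_of_poly (lambda k.+1).
Proof.
move=> k_gt0; rewrite /lambda.
have -> : (2 * k.+1 - 1 = 2 + (2 * k - 1))%N by lia.
have -> : (4 * k.+1 - 2 = 4 + (4 * k - 2))%N by lia.
rewrite !exprD; move: (2 * k - 1)%N (4 * k - 2)%N => a b.
rewrite /subst_xq2 !rmorphD !rmorphM !rmorphXn /= !rmorph1.
by rewrite -![fps_scale _ _]/(subst_xq2 _) subst_vx subst_vq rmorphM rmorphXn; ring.
Qed.

Lemma pprodS n : pprod n.+1 = pprod n * lambda n.+1.
Proof. by rewrite /pprod big_nat_recr. Qed.

(** The substitution shifts the factors lambda_1, ..., lambda_n to
    lambda_2, ..., lambda_(n+1). *)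
Lemma subst_pprod n :
  fps_of_poly (lambda 1) * subst_xq2 (fps_of_poly (pprod n))
  = fps_of_poly (pprod n.+1).
Proof.
elim: n => [|n IHn].
  by rewrite pprodS /pprod big_geq // !mul1r /subst_xq2 !rmorph1 mulr1.
rewrite [in LHS]pprodS [in RHS]pprodS [in RHS]rmorphM /= -IHn.
rewrite -(subst_lambda (ltn0Sn n)).
by rewrite /subst_xq2 !rmorphM /= mulrA.
Qed.

Lemma alladi_schur_sub m k :
  alladi_schur (m%:Z - k%:Z) = schur_poly (m - k)%N.
Proof.
rewrite /alladi_schur; case: ifP => [pos|neg]; first by congr schur_poly; lia.
have -> : (m - k = 0)%N by lia.
by case: schur_poly_rec => ->.
Qed.

Lemma eexp_even k : ~~ odd k -> eexp k%:Z = ((k + 5) %/ 6)%N%:Z.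
Proof.
move=> even_k; rewrite /eexp /chi_odd.
have -> : (2 %| k%:Z)%Z by lia.
by rewrite mulr0 addr0 subr0 -pmulrn ceil_div6.
Qed.

(** For odd n the exponent rounds up (n + 3) / 6, so that n is best written
    k - 3 with k even. *)
Lemma eexp_odd k : ~~ odd k -> eexp (k%:Z - 3) = ((k + 5) %/ 6)%N%:Z - 1.
Proof.
move=> even_k; rewrite /eexp /chi_odd.
have -> : (2 %| k%:Z - 3)%Z = false by lia.
by rewrite mulr1 subrK -pmulrn ceil_div6.
Qed.

(** With u = p_(e(2N-1))(x), v and w the denominators after the substitution,
    l = lambda_1 and l' the factor lambda of the theorem, both l' / v and
    1 / w equal l / u. *)
Lemma div_shift (R : comUnitRingType) (u v w l l' D A B X : R) :
  u \is a GRing.unit -> v \is a GRing.unit -> w \is a GRing.unit ->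
  l * v = u * l' -> l * w = u -> D = l * (A + X * B) ->
  D / u = l' * (A / v) + X * (B / w).
Proof.
move=> Uu Uv Uw lv lw ->.
have -> : l' = l * v / u by rewrite lv mulrAC divrr ?mul1r.
have -> : w^-1 = l / u.
  by apply: (mulrI Uw); rewrite divrr // mulrA [w * l]mulrC lw divrr.
have -> : l * v / u * (A / v) = l * A / u * (v / v) by ring.
by rewrite divrr // mulr1; ring.
Qed.

Theorem theorem2 (N : nat) (hN : (3 <= N)%N) :
  dtilde (2 * N%:Z - 1) =
    fps_of_poly (lambda `|Num.ceil ((2 * N + 2)%:R / 6 : rat)|%N)
      * subst_xq2 (dtilde (2 * N%:Z - 4))
    + fps_of_poly (vx * vq ^+ (2 * N - 1) * (1 - vx * vq))
      * subst_xq2 (dtilde (2 * N%:Z - 7)).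
Proof.
(* The denominators are p_(c+1), p_(c+1) and p_c, and the factor is
   lambda_(c+2). *)
have [c c_def] : exists c, ((2 * N + 7) %/ 6 = c.+2)%N.
  by exists ((2 * N + 7) %/ 6 - 2)%N; lia.
have e1 : eexp (2 * N%:Z - 1) = c.+1.
  have -> : 2 * N%:Z - 1 = (2 * N + 2)%N%:Z - 3 by lia.
  by rewrite eexp_odd; lia.
have e4 : eexp (2 * N%:Z - 4) = c.+1.
  have -> : 2 * N%:Z - 4 = (2 * N - 4)%N%:Z by lia.
  by rewrite eexp_even; lia.
have e7 : eexp (2 * N%:Z - 7) = c.
  have -> : 2 * N%:Z - 7 = (2 * N - 4)%N%:Z - 3 by lia.
  by rewrite eexp_odd; lia.
have schurE k : alladi_schur (2 * N%:Z - k%:Z) = schur_poly (2 * N - k)%N.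
  by rewrite -alladi_schur_sub PoszM.
have a1 : alladi_schur (2 * N%:Z - 1) = _ := schurE 1%N.
have a4 : alladi_schur (2 * N%:Z - 4) = _ := schurE 4%N.
have a7 : alladi_schur (2 * N%:Z - 7) = _ := schurE 7%N.
rewrite ceil_div6 -addnA c_def /dtilde e1 e4 e7 a1 a4 a7 !absz_nat.
have rec_d := schur_rec_morph (@fps_of_poly {poly int}) schur_poly_rec.
have := schur_rec_morph (fps_scale ('X ^+ 2)) rec_d.
rewrite /= -![fps_scale _ (fps_of_poly _)]/(subst_xq2 _) subst_vx subst_vq.
rewrite rmorphM rmorphXn /= => rec_e.
rewrite /subst_xq2 !rmorph_div ?pprod_unit //=.
apply: (@div_shift _ _ _ _ (fps_of_poly (lambda 1))).
- exact: pprod_unit.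
- exact/rmorph_unit/pprod_unit.
- exact/rmorph_unit/pprod_unit.
- by rewrite [LHS]subst_pprod pprodS rmorphM.
- exact: subst_pprod.
have := shift_identity_odd rec_d rec_e hN; rewrite /shift_identity -!subnDA /= => ->.
rewrite /lambda !rmorphD !rmorphM !rmorphXn rmorphB rmorphM !rmorph1 /=.
by rewrite !expr1.
Qed.
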